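(* For every integer $n\ge 6$, $\chi_l(K(n,3))=n-4$.
   Context: The Kneser graph $K(n,3)$ has as vertices all $3$-subsets of $[n]$, two being adjacent iff disjoint. A proper coloring of a graph assigns colors to vertices so that adjacent vertices get distinct colors. The locality of a proper coloring is the maximum, over vertices $v$, of the number of distinct colors appearing on the closed neighborhood $\{v\}\cup N(v)$. The local chromatic number $\chi_l(G)$ is the minimum locality of a proper coloring of $G$. *)

(* Defs.v *)
From mathcomp Require Import all_boot.
Set Implicit Arguments. Unset Strict Implicit. Unset Printing Implicit Defensive.

Definition kvert (n k : nat) := {A : {set 'I_n} | #|A| == k}.

Definition kadj (n k : nat) (u v : kvert n k) : bool := [disjoint val u & val v].

(* Proper coloring with colors in nat (arbitrary color set). *)
Definition proper_coloring (n k : nat) (c : kvert n k -> nat) : Prop :=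
  forall u v : kvert n k, kadj u v -> c u != c v.

Definition closed_nbhd_colors (n k : nat) (c : kvert n k -> nat) (v : kvert n k) : nat :=
  size (undup [seq c u | u <- enum [pred u : kvert n k | (u == v) || kadj v u]]).

Definition locality (n k : nat) (c : kvert n k -> nat) : nat :=
  \max_(v : kvert n k) closed_nbhd_colors c v.

Definition local_chromatic_number_is (n k m : nat) : Prop :=
  (exists c : kvert n k -> nat, proper_coloring c /\ locality c = m) /\
  (forall c : kvert n k -> nat, proper_coloring c -> m <= locality c).

(* Main.v *)
Require Import Defs.
From mathcomp Require Import all_boot.
From mathcomp Require Import zify.
Set Implicit Arguments. Unset Strict Implicit. Unset Printing Implicit Defensive.

(** Lower bound: by induction on [N = #|R|], some triple [A] of [R] is such that
    the triples of [R :\: A] get at least [N - 5] colours; the colour of [A]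
    itself is one more.  Suppose every [R :\: A] shows at most [N - 6] colours.

    For a colour [k], let [G] be the set of triples of [R] meeting all triples of
    colour [k].  If all members of [G] contain a point [x], the induction
    hypothesis for [R :\ x] gives an [A] missing [x], so [A] is not in [G], and
    colour [k] is visible outside [A] on top of the [N - 6] colours found in
    [R :\ x :\: A].  So no [G] has a common point.

    The induction hypothesis also yields [X] with [m = N - 4] points whose triples
    show exactly [m - 2] colours; since [X] plus one point still fits outside some
    triple, every triple with at least two points in [X] has one of these colours.
    Give weight [m - 5] to the triples inside [X] and [m - 2] to those with exactly
    two points in [X].  Every pair of points then has degree at most
    [(m - 1)(m - 2)], and a weighted Hilton-Milner bound limits each colour class to
    [(3(m - 1) + 1)(m - 2)].  For [m >= 5] the [m - 2] classes cannot cover the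
    total weight.  The cases [N = 7, 8] are treated directly. *)

(** * Three-element sets *)

Section Triples.
Variable V : finType.
Implicit Types (x y z : V) (A T : {set V}).

Lemma cards3 x y z : uniq [:: x; y; z] -> #|[set x; y; z]| = 3.
Proof.
rewrite /= !inE negb_or => /andP[/andP[xy xz] /andP[yz _]].
by rewrite setUC cardsU1 !inE negb_or ![z == _]eq_sym xz yz cards2 xy.
Qed.

Lemma set3_of A x : #|A| = 3 -> x \in A ->
  exists y z, uniq [:: x; y; z] /\ A = [set x; y; z].
Proof.
move=> A3 xA; have /cards2P[y [z [yz Axe]]] : #|A :\ x| == 2.
  by rewrite -eqSS -A3 (cardsD1 x A) xA.
exists y, z; split; last by rewrite -(setD1K xA) Axe setUA.
have : x \notin A :\ x by rewrite !inE eqxx.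
by rewrite Axe /= !inE yz => ->.
Qed.

Lemma eq_set3 T x y z : #|T| = 3 -> uniq [:: x; y; z] ->
  x \in T -> y \in T -> z \in T -> T = [set x; y; z].
Proof.
move=> T3 u xT yT zT; apply/esym/eqP; rewrite eqEcard T3 cards3 // leqnn andbT.
by apply/subsetP => t; rewrite !inE => /orP[/orP[]|] /eqP->.
Qed.

End Triples.

(** * A weighted Hilton-Milner bound *)

Section WeightedIntersecting.
Variables (V : finType) (F G : {set {set V}}).
Hypothesis F3 : forall T, T \in F -> #|T| = 3.
Hypothesis G3 : forall A, A \in G -> #|A| = 3.
Hypothesis FG : F \subset G.
Hypothesis cross : forall T A, T \in F -> A \in G -> exists2 x, x \in T & x \in A.
Hypothesis Gnostar : forall x, exists2 A, A \in G & x \notin A.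

(** Such a pair is a two-point cover of [G]. Only heavy pairs can lie in many members of [F]: a
    member of [G] avoiding a light pair leaves three candidates for the third point. *)
Definition heavy (x y : V) := [forall A in G, (x \in A) || (y \in A)].

Lemma heavyE x y A : heavy x y -> A \in G -> x \notin A -> y \in A.
Proof. by move=> /forall_inP h /h /orP[-> //|]. Qed.

Lemma heavyC x y : heavy x y = heavy y x.
Proof. by apply: eq_forallb => A; rewrite orbC. Qed.

Lemma lightP x y : ~~ heavy x y ->
  exists A, [/\ A \in G, x \notin A & y \notin A].
Proof. by case/forall_inPn => A AG; rewrite negb_or => /andP[? ?]; exists A. Qed.

(** Since [T] meets [A], which misses [x] and [y], its third point is in [A]; excluding [e] leaves
    two choices. *)
Lemma light_pair_list A e x y : A \in G -> e \in A -> x != y ->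
  x \notin A -> y \notin A ->
  exists2 l : seq {set V}, size l = 2 &
    forall T, T \in F -> x \in T -> y \in T -> e \notin T -> T \in l.
Proof.
move=> AG eA xy xA yA; have [s [t [u Ae]]] := set3_of (G3 AG) eA.
exists [:: [set x; y; s]; [set x; y; t]] => // T TF xT yT eT.
have [z zT zA] := cross TF AG.
have zx : x != z by apply: contraNneq xA => ->.
have zy : y != z by apply: contraNneq yA => ->.
have Txyz : T = [set x; y; z].
  by apply: eq_set3 => //; rewrite ?F3 //= !inE negb_or xy zx zy.
move: zA; rewrite Ae !inE -orbA => /or3P[] /eqP ze.
- by rewrite -ze zT in eT.
- by rewrite Txyz ze eqxx.
- by rewrite Txyz ze eqxx orbT.
Qed.

Variables (w : {set V} -> nat) (D M : nat).
Hypothesis wM : forall T, w T <= M.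
Hypothesis wD : forall x y, x != y ->
  \sum_(T in F | (x \in T) && (y \in T)) w T <= D * M.

(** Union bound: a pair costs at most [D * M], a single triple at most [M]. Each case below then
    only needs a cover within the budget [3 * D + 1]. *)
Lemma cover_weight (Lp : seq (V * V)) (Ls : seq {set V}) n :
  all (fun p => p.1 != p.2) Lp -> size Lp * D + size Ls <= n ->
  (forall T, T \in F ->
     has (fun p => (p.1 \in T) && (p.2 \in T)) Lp || (T \in Ls)) ->
  \sum_(T in F) w T <= n * M.
Proof.
move=> Lpne le_n cov; apply: leq_trans (leq_mul le_n (leqnn M)).
have bp : \sum_(p <- Lp) \sum_(T in F | (p.1 \in T) && (p.2 \in T)) w T
          <= size Lp * D * M.
  elim: Lp Lpne {cov le_n} => [|p L IH] /=; first by rewrite big_nil.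
  move=> /andP[p12 /IH {}IH]; rewrite big_cons mulSn mulnDl.
  exact: leq_add (wD p12) IH.
have bs : \sum_(S <- Ls) \sum_(T in F | T == S) w T <= size Ls * M.
  elim: Ls {cov le_n} => [|S L IH] /=; first by rewrite big_nil.
  rewrite big_cons mulSn; apply: leq_add IH.
  rewrite (eq_bigl (fun T => (T == S) && (S \in F))); last first.
    by move=> T; rewrite andbC; case: eqP => // ->.
  case: (S \in F); last by rewrite big_pred0 // => T; rewrite andbF.
  by rewrite (eq_bigl _ _ (fun T => andbT _)) big_pred1_eq.
rewrite mulnDl; apply: leq_trans (leq_add bp bs).
under [X in _ <= X + _]eq_bigr do rewrite big_mkcondr.
under [X in _ <= _ + X]eq_bigr do rewrite big_mkcondr.
rewrite exchange_big [X in _ <= _ + X]exchange_big -big_split.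
apply: leq_sum => T TF /=; case/orP: (cov T TF).
  case/hasP => p pL pT; apply: leq_trans (leq_addr _ _).
  by rewrite (big_rem p) //= pT leq_addr.
move=> TL; apply: leq_trans (leq_addl _ _).
by rewrite (big_rem T) //= eqxx leq_addr.
Qed.

(** A member of [G] avoiding [a] is some [{b, c, d}]. So members of [F] through [a] meet
    [{b, c, d}], and all others contain both [b] and [c]. *)
Lemma weight_two_heavy a b c : uniq [:: a; b; c] -> 4 <= D ->
  heavy a b -> heavy a c -> \sum_(T in F) w T <= (3 * D + 1) * M.
Proof.
move=> u D4 hab hac.
have [A AG aA] := Gnostar a.
have bA := heavyE hab AG aA; have cA := heavyE hac AG aA.
have /=/andP[] := u; rewrite !inE negb_or andbT => /andP[ab ac] bc.
have [d] : exists d, uniq [:: b; c; d] /\ A = [set b; c; d].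
  have [s [t [uA Ae]]] := set3_of (G3 AG) bA.
  move: cA uA; rewrite Ae !inE -orbA eq_sym (negbTE bc) /=.
  by case/orP => /eqP ce; subst; [exists t | exists s; split => //;
    [move: uA; rewrite /= !inE !negb_or [s == t]eq_sym andbT => /andP[/andP[-> ->] ->]
    | rewrite setUAC]].
case=> uA Ae.
have ad : a != d by apply: contraNneq aA => ->; rewrite Ae !inE eqxx !orbT.
have Ta T : T \in F -> a \in T -> [|| b \in T, c \in T | d \in T].
  move=> TF aT; have [z zT] := cross TF AG.
  by rewrite Ae !inE -orbA => /or3P[] /eqP <-; rewrite zT ?orbT.
have TNa T : T \in F -> a \notin T -> (b \in T) && (c \in T).
  move=> TF aT; have TG := subsetP FG _ TF.
  by rewrite (heavyE hab) ?(heavyE hac).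
have [had|/lightP[A' [A'G aA' dA']]] := boolP (heavy a d).
  apply: (@cover_weight [:: (a, b); (a, c); (a, d)] [:: [set b; c; d]]);
    [by rewrite /= ab ac ad | by [] | move=> T TF /=].
  have [aT|aT] := boolP (a \in T).
    by case/or3P: (Ta T TF aT) => ->; rewrite ?orbT.
  rewrite !andFb /= mem_seq1; apply/eqP.
  have /andP[bT cT] := TNa T TF aT.
  apply: eq_set3 => //; rewrite ?F3 // .
  exact: (heavyE had (subsetP FG _ TF)).
have [hbc|/lightP[A2 [A2G bA2 cA2]]] := boolP (heavy b c).
  apply: (@cover_weight [:: (a, b); (a, c); (b, c)] [::]);
    [by rewrite /= ab ac bc | by rewrite leq_add | move=> T TF /=].
  have [aT|aT] := boolP (a \in T).
    case: (boolP (b \in T)) => //= bT.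
    by rewrite (heavyE hbc) // (subsetP FG).
  by rewrite TNa ?orbT.
have bA' := heavyE hab A'G aA'; have aA2 : a \in A2.
  by apply: (@heavyE b) A2G bA2; rewrite heavyC.
(* With [{a, d}] and [{b, c}] light, at most four triples escape the pairs [{a, b}] and [{a, c}]:
   two through [a, d] without [b], two through [b, c] without [a]. *)
have [l1 s1 L1] := light_pair_list A'G bA' ad aA' dA'.
have [l2 s2 L2] := light_pair_list A2G aA2 bc bA2 cA2.
apply: (@cover_weight [:: (a, b); (a, c)] (l1 ++ l2));
  [by rewrite /= ab ac | by rewrite size_cat s1 s2 /=; move: D4; clear; lia | move=> T TF /=].
have [aT|aT] := boolP (a \in T).
  case: (boolP (b \in T)) => //= bT; case: (boolP (c \in T)) => //= cT.
  rewrite mem_cat L1 //.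
  by move: (Ta T TF aT); rewrite (negbTE bT) (negbTE cT).
by have /andP[bT cT] := TNa T TF aT; rewrite mem_cat L2 ?orbT.
Qed.

(** A member of [G] avoiding [a] is some [{b, s, t}], so [T] contains [s] or [t]. The pairs [{a, s}]
    and [{a, t}] are light, and a member of [G] avoiding either must contain [b]: two triples for
    each. *)
Lemma heavy_side_list a b : a != b -> heavy a b ->
  (forall c, c != a -> c != b -> ~~ heavy a c) ->
  exists2 l : seq {set V}, size l = 4 &
    forall T, T \in F -> a \in T -> b \notin T -> T \in l.
Proof.
move=> ab hab nh; have [A AG aA] := Gnostar a.
have [s [t [u Ae]]] := set3_of (G3 AG) (heavyE hab AG aA).
have H c : c \in A -> c != b -> exists2 l : seq {set V}, size l = 2 &
    forall T, T \in F -> a \in T -> c \in T -> b \notin T -> T \in l.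
  move=> cA cb; have ca : c != a by apply: contraNneq aA => <-.
  have [A' [A'G aA' cA']] := lightP (nh c ca cb).
  apply: (light_pair_list A'G _ _ aA' cA'); last by rewrite eq_sym.
  exact: (heavyE hab A'G aA').
move: (u) => /=; rewrite !inE negb_or andbT => /andP[/andP[bs bt] st].
have [||l1 s1 L1] := H s; rewrite 1?eq_sym // ?Ae ?inE ?eqxx ?orbT //.
have [||l2 s2 L2] := H t; rewrite 1?eq_sym // ?Ae ?inE ?eqxx ?orbT //.
exists (l1 ++ l2) => [|T TF aT bT]; first by rewrite size_cat s1 s2.
have [z zT] := cross TF AG; rewrite mem_cat Ae !inE -orbA.
case/or3P => /eqP ze; subst z; first by rewrite zT in bT.
  by rewrite L1.
by rewrite L2 ?orbT.
Qed.

(* Lists what meets [{a, b, c}] in [{c}] or in [{a, b}].  A second member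
   [{a, b, y}] of [F] forces [y] into every member meeting [{a, b, c}] in [{c}],
   which is why both kinds together number at most 4. *)
Lemma all_light_list a b c : uniq [:: a; b; c] -> [set a; b; c] \in F ->
  (forall x y, x != y -> ~~ heavy x y) ->
  exists2 l : seq {set V}, size l = 4 & forall T, T \in F ->
    T != [set a; b; c] ->
    [&& c \in T, a \notin T & b \notin T] || (a \in T) && (b \in T) -> T \in l.
Proof.
move=> u T1F nh.
move: (u) => /=; rewrite !inE negb_or andbT => /andP[/andP[ab ac] bc].
have hitT1 A : A \in G -> c \notin A -> (a \in A) \/ (b \in A).
  move=> AG cA; have [z] := cross T1F AG.
  rewrite !inE -orbA => /or3P[] /eqP-> // zA; try by [left|right].
  by rewrite zA in cA.
have pairC y : y != c -> exists2 l : seq {set V}, size l = 2 & forall T,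
    T \in F -> c \in T -> y \in T -> a \notin T -> b \notin T -> T \in l.
  move=> yc; have [A [AG cA yA]] : exists A, [/\ A \in G, c \notin A & y \notin A].
    by apply: lightP; apply: nh; rewrite eq_sym.
  have cy : c != y by rewrite eq_sym.
  case: (hitT1 A AG cA) => eA; have [l sl L] := light_pair_list AG eA cy cA yA;
    exists l => // T TF cT yT aT bT; exact: L.
have [A [AG aA bA]] := lightP (nh a b ab).
have cA : c \in A.
  have [z] := cross T1F AG; rewrite !inE -orbA => /or3P[] /eqP-> // zA.
    by rewrite zA in aA.
  by rewrite zA in bA.
have [l0 s0 L0] := light_pair_list AG cA ab aA bA.
have cN T : T \in F -> T != [set a; b; c] -> a \in T -> b \in T -> c \notin T.
  by move=> TF TN aT bT; apply: contraNN TN => cT; apply/eqP/eq_set3; rewrite ?F3.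
have [/exists_inP[T2 T2F /and3P[T2N aT2 bT2]]|] :=
    boolP [exists T in F, [&& T != [set a; b; c], a \in T & b \in T]].
  have cT2 := cN _ T2F T2N aT2 bT2.
  have [s [t [u2 T2e]]] := set3_of (F3 T2F) aT2.
  have [y [yc T2y]] : exists y, y != c /\ {subset T2 <= [set a; b; y]}.
    move: bT2 cT2; rewrite T2e !inE eq_sym (negbTE ab) /= !negb_or.
    case/orP => /eqP be; subst => /andP[/andP[_ cs] ct].
      by exists t; rewrite eq_sym; split => // x; rewrite !inE.
    by exists s; rewrite eq_sym; split => // x; rewrite !inE orbAC.
  have [l1 s1 L1] := pairC y yc.
  exists (l0 ++ l1) => [|T TF TN]; first by rewrite size_cat s0 s1.
  rewrite mem_cat; case/orP => [/and3P[cT aT bT]|/andP[aT bT]]; last first.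
    by rewrite L0 // cN.
  rewrite L1 ?orbT //.
  have [z zT zT2] := cross TF (subsetP FG _ T2F).
  move: (T2y z zT2); rewrite !inE -orbA => /or3P[] /eqP ze; subst => //.
    by rewrite zT in aT.
  by rewrite zT in bT.
move=> /exists_inPn noab.
(* Only triples meeting [{a, b, c}] in [{c}] remain. [A'] avoids [c] and contains [a] or [b], so
   they meet it in [s] or [t]. *)
have [A' A'G cA'] := Gnostar c.
have [e [eab eA']] : exists e, e \in [:: a; b] /\ e \in A'.
  by case: (hitT1 A' A'G cA'); [exists a|exists b]; rewrite !inE eqxx ?orbT.
have [s [t [ue A'e]]] := set3_of (G3 A'G) eA'.
have sc : s != c by apply: contraNneq cA' => <-; rewrite A'e !inE eqxx ?orbT.
have tc : t != c by apply: contraNneq cA' => <-; rewrite A'e !inE eqxx ?orbT.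
have [l1 s1 L1] := pairC s sc; have [l2 s2 L2] := pairC t tc.
exists (l1 ++ l2) => [|T TF TN]; first by rewrite size_cat s1 s2.
case/orP => [/and3P[cT aT bT]|abT]; last by have := noab T TF; rewrite TN abT.
have [z zT] := cross TF A'G; rewrite A'e !inE -orbA mem_cat.
case/or3P => /eqP ze; subst z.
- by move: eab; rewrite !inE => /orP[] /eqP ze; subst; rewrite zT in aT bT.
- by rewrite L1.
- by rewrite L2 ?orbT.
Qed.

(* In the extremal case three heavy pairs through a common point contribute
   [3 * D] and the triple avoiding that point contributes the [+ 1]; without
   heavy pairs [F] has at most 13 members, whence the assumption on [D]. *)
Theorem intersecting_weight_le : 4 <= D -> \sum_(T in F) w T <= (3 * D + 1) * M.
Proof.
move=> D4.
have [/existsP[a /existsP[b /andP[ab hab]]]|/existsPn nh] :=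
    boolP [exists a, exists b, (a != b) && heavy a b].
  have [/existsP[c /and3P[ca cb]]|/existsPn nc] :=
      boolP [exists c, [&& c != a, c != b & heavy a c || heavy b c]].
    case/orP => hc.
      by apply: (@weight_two_heavy a b c) => //=; rewrite !inE negb_or ab ![_ == c]eq_sym ca cb.
    apply: (@weight_two_heavy b a c) => //=; last by rewrite heavyC.
    by rewrite !inE negb_or eq_sym ab ![_ == c]eq_sym ca cb.
  have [|l1 s1 L1] := @heavy_side_list a b ab hab.
    by move=> c ca cb; move: (nc c); rewrite ca cb negb_or => /andP[].
  have ba : b != a by rewrite eq_sym.
  have hba : heavy b a by rewrite heavyC.
  have [|l2 s2 L2] := @heavy_side_list b a ba hba.
    by move=> c cb ca; move: (nc c); rewrite ca cb negb_or => /andP[].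
  (* The heavy pair costs [D] and each side four triples; [D + 8 <= 3 * D + 1] follows from
     [4 <= D]. *)
  apply: (@cover_weight [:: (a, b)] (l1 ++ l2));
    [by rewrite /= ab | by rewrite size_cat s1 s2 /=; move: D4; clear; lia | move=> T TF /=].
  have TG := subsetP FG _ TF; rewrite mem_cat orbF.
  have [aT|aT] := boolP (a \in T).
    by have [//|bT] := boolP (b \in T); rewrite L1.
  by rewrite L2 ?orbT // (heavyE hab).
have {}nh x y : x != y -> ~~ heavy x y.
  by move=> xy; have /existsPn/(_ y) := nh x; rewrite xy.
have [->|[T1 T1F]] := set_0Vmem F; first by rewrite big_set0.
have [a aT1] : exists a, a \in T1 by apply/card_gt0P; rewrite F3.
have [b [c [u T1e]]] := set3_of (F3 T1F) aT1.
have E1 : [set b; c; a] = T1 by rewrite T1e -[RHS]setUA [LHS]setUC.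
have E2 : [set c; a; b] = T1 by rewrite T1e -[LHS]setUA [LHS]setUC.
have u1 : uniq [:: b; c; a] by rewrite -(rot_uniq 2) /rot /=.
have u2 : uniq [:: c; a; b] by rewrite -(rot_uniq 1) /rot /=.
(* Any other member of [F] meets [T1] in one or two points. The three rotations of [(a, b, c)] cover
   all these traces, for a total of [1 + 3 * 4] triples. *)
have [||l1 s1 L1] := all_light_list u; rewrite -?T1e //.
have [||l2 s2 L2] := all_light_list u1; rewrite ?E1 //.
have [||l3 s3 L3] := all_light_list u2; rewrite ?E2 //.
rewrite -T1e in L1; rewrite E1 in L2; rewrite E2 in L3.
apply: (@cover_weight [::] (T1 :: l1 ++ l2 ++ l3)) => //.
  by rewrite /= !size_cat s1 s2 s3; move: D4; clear; lia.
move=> T TF /=; rewrite inE !mem_cat; have [//|TN] := eqVneq T T1.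
have := L1 T TF TN; have := L2 T TF TN; have := L3 T TF TN.
have [z zT] := cross TF (subsetP FG _ T1F); rewrite T1e !inE -orbA.
have : [|| z == a, z == b | z == c] -> [|| a \in T, b \in T | c \in T].
  by case/or3P => /eqP <-; rewrite zT ?orbT.
move=> H /H{H}; case: (a \in T); case: (b \in T); case: (c \in T) => //= _ H3 H2 H1;
  first [by rewrite H1 | by rewrite H2 ?orbT | by rewrite H3 ?orbT].
Qed.

End WeightedIntersecting.

(** Reduces distinctness of points picked from a list to a computation on indices. *)
Lemma uniq_sel (T : eqType) x0 (l : seq T) (s : seq nat) : uniq l ->
  uniq s && all (fun i => i < size l) s -> uniq [seq nth x0 l i | i <- s].
Proof.
move=> ul /andP[us /allP ls]; rewrite map_inj_in_uniq // => i j /ls il /ls jl.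
by move/eqP; rewrite nth_uniq // => /eqP.
Qed.

(** * Colours shown by the triples of a point set *)

Section Coloring.
Variables (V K : finType) (col : {set V} -> K).
Implicit Types (R S T X Z A : {set V}).

Definition triples R := [set T : {set V} | T \subset R & #|T| == 3].
Definition colors R := col @: triples R.

Lemma triplesP R T : reflect (T \subset R /\ #|T| = 3) (T \in triples R).
Proof. by rewrite inE; apply: (iffP andP) => -[? /eqP]. Qed.

Lemma triples3 R x y z : uniq [:: x; y; z] -> x \in R -> y \in R -> z \in R ->
  [set x; y; z] \in triples R.
Proof.
move=> u xR yR zR; apply/triplesP; split; last exact: cards3.
by rewrite !subUset !sub1set xR yR zR.
Qed.

Lemma triplesS R S : R \subset S -> triples R \subset triples S.
Proof.
move=> RS; apply/subsetP => T /triplesP[TR T3]; apply/triplesP; split=> //.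
exact: subset_trans RS.
Qed.

Lemma colorsS R S : R \subset S -> colors R \subset colors S.
Proof. by move=> RS; apply/imsetS/triplesS. Qed.

Lemma exists_triple R : 3 <= #|R| -> exists A, A \in triples R.
Proof.
by move=> R3; apply/card_gt0P; rewrite cards_draws bin_gt0.
Qed.

Lemma exists_triple_avoiding R Z : Z \subset R -> #|Z| + 3 <= #|R| ->
  exists2 A, A \in triples R & Z \subset R :\: A.
Proof.
move=> ZR Zc; have [|A] := @exists_triple (R :\: Z).
  by rewrite cardsD (setIidPr ZR) leq_subRL ?subset_leq_card.
move=> /triplesP[]; rewrite subsetD => /andP[AR dAZ] A3; exists A.
  by apply/triplesP.
by rewrite subsetD ZR disjoint_sym.
Qed.

Hypothesis col_proper :
  forall S T, #|S| = 3 -> #|T| = 3 -> [disjoint S & T] -> col S != col T.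

Lemma disjoint3 (a b c d e f : V) : uniq [:: a; b; c; d; e; f] ->
  [disjoint [set a; b; c] & [set d; e; f]].
Proof.
rewrite -[X in uniq X]/([:: a; b; c] ++ [:: d; e; f]) cat_uniq => /and3P[_ h _].
rewrite disjoint_subset; apply/subsetP => x xS; apply: contraNN h => xT.
by apply/hasP; exists x; move: xS xT; rewrite /= !inE -!orbA.
Qed.

(** Slide a window of three along six points: consecutive windows span four points, yet the first
    and the last are disjoint. *)
Lemma not_locally_constant R : 6 <= #|R| ->
  ~ {in triples R &, forall S T, #|S :|: T| <= 4 -> col S = col T}.
Proof.
case/card_geqP=> -[|a [|b [|c [|d [|e [|f [|g s]]]]]]] [u // _ sR] H.
set l := [:: a; b; c; d; e; f] in u sR.
have step x y z t : uniq [:: x; y; z; t] -> {subset [:: x; y; z; t] <= R} ->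
    col [set x; y; z] = col [set y; z; t].
  move=> u4 s4; apply: H.
  - by apply: triples3; rewrite ?s4 ?inE ?eqxx ?orbT //; exact: take_uniq 3 u4.
  - by apply: triples3; rewrite ?s4 ?inE ?eqxx ?orbT //; exact: drop_uniq 1 u4.
  have -> : [set x; y; z] :|: [set y; z; t] = [set x; y; z; t].
    apply/setP => v; rewrite !inE.
    by case: (v == x); case: (v == y); case: (v == z).
  apply: leq_trans (leq_card_setU _ _) _.
  by rewrite cards1 addn1 ltnS cards3 //; exact: take_uniq 3 u4.
have window i : uniq (take 4 (drop i l)) /\ {subset take 4 (drop i l) <= R}.
  by split=> [|x /mem_take/mem_drop/sR]; first exact/take_uniq/drop_uniq.
have [u0 s0] := window 0; have [u1 s1] := window 1; have [u2 s2] := window 2.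
have := col_proper (cards3 (take_uniq 3 u)) (cards3 (drop_uniq 3 u)) (disjoint3 u).
by rewrite (step _ _ _ _ u0 s0) (step _ _ _ _ u1 s1) (step _ _ _ _ u2 s2) eqxx.
Qed.

(** The negation of the lower bound on [R], assumed for contradiction. Truncated subtraction makes
    it fail when [3 <= #|R| <= 5]. *)
Definition few_colors R := forall A, A \in triples R -> #|colors (R :\: A)| < #|R| - 5.

Lemma few_colors_sub R Z : few_colors R -> Z \subset R -> #|Z| + 3 <= #|R| ->
  #|colors Z| < #|R| - 5.
Proof.
move=> Hno ZR Zc; have [A AR ZA] := exists_triple_avoiding ZR Zc.
exact: leq_ltn_trans (subset_leq_card (colorsS ZA)) (Hno A AR).
Qed.

(** [Z :|: T] has at most one point more than [Z], so it still fits outside a triple and cannot show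
    a colour beyond those of [Z]. *)
Lemma dominated_color R Z T x y : few_colors R -> Z \subset R -> #|Z| + 4 <= #|R| ->
  #|R| - 6 <= #|colors Z| -> T \in triples R ->
  x != y -> x \in T -> y \in T -> x \in Z -> y \in Z -> col T \in colors Z.
Proof.
move=> Hno ZR Zc cZ TR xy xT yT xZ yZ; have [TsR T3] := triplesP _ _ TR.
have U1 : #|Z :|: T| <= #|Z| + 1.
  rewrite cardsU T3; have : [set x; y] \subset Z :&: T.
    by rewrite subsetI !subUset !sub1set xZ yZ xT yT.
  move/subset_leq_card; rewrite cards2 xy; clear; lia.
have US : Z :|: T \subset R by rewrite subUset ZR TsR.
have Uc : #|Z :|: T| + 3 <= #|R| by move: U1 Zc; clear; lia.
have := few_colors_sub Hno US Uc => cU.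
have -> : colors Z = colors (Z :|: T).
  apply/eqP; rewrite eqEcard colorsS ?subsetUl //=.
  by move: cU cZ; clear; lia.
by apply/imset_f/triplesP; rewrite subsetUr.
Qed.

(** * Eight points *)

Section EightPoints.
Variable R : {set V}.
Hypotheses (R8 : #|R| = 8) (few : few_colors R).

Lemma two_colors Z S1 S2 T x y : Z \subset R -> #|Z| = 4 ->
  S1 \in triples Z -> S2 \in triples Z -> col S1 != col S2 ->
  T \in triples R -> x != y -> x \in T -> y \in T -> x \in Z -> y \in Z ->
  col T = col S1 \/ col T = col S2.
Proof.
move=> ZR Z4 S1Z S2Z S12 TR xy xT yT xZ yZ.
have sub : [set col S1; col S2] \subset colors Z.
  by rewrite subUset !sub1set !imset_f.
have := few_colors_sub few ZR; rewrite Z4 R8 => /(_ isT); rewrite ltnS => cZ.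
have c2 : #|[set col S1; col S2]| = 2 by rewrite cards2 S12.
have Ze : [set col S1; col S2] = colors Z.
  by apply/eqP; rewrite eqEcard sub c2.
have : col T \in colors Z.
  by apply: (@dominated_color R Z T x y) => //; rewrite ?Z4 ?R8 // -Ze c2.
by rewrite -Ze !inE => /orP[] /eqP; [left|right].
Qed.

Lemma two_colors4 a b c d S1 S2 T x y : uniq [:: a; b; c; d] ->
  {subset [:: a; b; c; d] <= R} ->
  S1 \in triples [set a; b; c; d] -> S2 \in triples [set a; b; c; d] ->
  col S1 != col S2 -> T \in triples R -> x != y -> x \in T -> y \in T ->
  x \in [:: a; b; c; d] -> y \in [:: a; b; c; d] ->
  col T = col S1 \/ col T = col S2.
Proof.
move=> u s4 S1Z S2Z S12 TR xy xT yT xZ yZ.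
have inZ v : v \in [:: a; b; c; d] -> v \in [set a; b; c; d] by rewrite !inE -!orbA.
apply: (@two_colors [set a; b; c; d] S1 S2 T x y) => //; try exact: inZ.
  by apply/subsetP => v vZ; apply: s4; move: vZ; rewrite !inE -!orbA.
rewrite setUC cardsU1 cards3; last exact: take_uniq 3 u.
move: u; rewrite -(rot_uniq 3) cons_uniq => /andP[+ _]; rewrite !inE -!orbA => /negbTE -> //.
Qed.

Variables (X P1 P2 : {set V}).
Hypotheses (XR : X \subset R) (X4 : #|X| = 4).
Hypotheses (P1X : P1 \in triples X) (P2X : P2 \in triples X).
Hypothesis P12 : col P1 != col P2.

(** The aim is that every triple of [R] is old; triples with at least two, one and no points in [X]
    are treated in turn. *)
Let old T := (col T == col P1) || (col T == col P2).

Lemma old_meet2 T x y : T \in triples R -> x != y -> x \in T -> y \in T ->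
  x \in X -> y \in X -> old T.
Proof.
move=> TR xy xT yT xX yX.
by case: (two_colors XR X4 P1X P2X P12 TR xy xT yT xX yX) => e;
  rewrite /old e eqxx ?orbT.
Qed.

(* The two colours seen on [{p, q, r, s}] are a new one and that of [U], so an
   old colour there can only be that of [U]. *)
Lemma old_pinned p q r s S U T x y : uniq [:: p; q; r; s] ->
  {subset [:: p; q; r; s] <= R} ->
  S \in triples [set p; q; r; s] -> U \in triples [set p; q; r; s] ->
  ~~ old S -> old U -> old T ->
  T \in triples R -> x != y -> x \in T -> y \in T ->
  x \in [:: p; q; r; s] -> y \in [:: p; q; r; s] -> col T = col U.
Proof.
move=> u s4 SZ UZ oS oU oT TR xy xT yT xZ yZ.
have SU : col S != col U by apply: contraNneq oS => e; rewrite /old e.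
have [e|//] := two_colors4 u s4 SZ UZ SU TR xy xT yT xZ yZ.
by move: oS; rewrite /old -e -/(old T) oT.
Qed.

Local Ltac mem := by rewrite ?inE ?eqxx ?orbT.

(** If [ayz] were new, [{a, b, y, z}] would force [bcy] and [ady] to share the colour of [aby], and
    [{a, d, y, z}] would give [adw] the colour of [ady]. But [bcy] and [adw] are disjoint. *)
Lemma old_meet1_list a b c d y z w : uniq [:: a; b; c; d; y; z; w] ->
  {subset [:: a; b; c; d; y; z; w] <= R} -> {subset [:: a; b; c; d] <= X} ->
  old [set a; y; z].
Proof.
move=> u sR sX; apply: contraT => nT.
have us s := @uniq_sel _ a _ s u.
have inR i : i < 7 -> nth a [:: a; b; c; d; y; z; w] i \in R.
  by move=> i7; apply/sR/mem_nth.
have tri p q r Z : uniq [:: p; q; r] && all (fun x => x \in Z) [:: p; q; r] ->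
    [set p; q; r] \in triples Z.
  by case/andP=> upqr /and4P[*]; exact: triples3.
have four p q r s : uniq [:: p; q; r; s] && all (fun i => i < 7) [:: p; q; r; s] ->
  let l := [seq nth a [:: a; b; c; d; y; z; w] i | i <- [:: p; q; r; s]] in
  uniq l /\ {subset l <= R}.
  move=> h; split; first exact: us.
  by move=> x /mapP[i il ->]; apply: inR; case/andP: h => _ /allP; apply.
have [uab sab] := four 0 1 4 5 isT; have [uad sad] := four 0 3 4 5 isT.
have aby : [set a; b; y] \in triples R.
  by apply: tri; rewrite (us [:: 0; 1; 4]) //= !sR //; mem.
have bcy : [set b; c; y] \in triples R.
  by apply: tri; rewrite (us [:: 1; 2; 4]) //= !sR //; mem.
have ady : [set a; d; y] \in triples R.
  by apply: tri; rewrite (us [:: 0; 3; 4]) //= !sR //; mem.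
have adw : [set a; d; w] \in triples R.
  by apply: tri; rewrite (us [:: 0; 3; 6]) //= !sR //; mem.
have ne i j : [&& i < 7, j < 7 & i != j] ->
    nth a [:: a; b; c; d; y; z; w] i != nth a [:: a; b; c; d; y; z; w] j.
  by case/and3P => i7 j7; rewrite nth_uniq.
have oaby : old [set a; b; y].
  by apply: (old_meet2 aby (ne 0 1 isT)); rewrite ?sX //; mem.
have obcy : old [set b; c; y].
  by apply: (old_meet2 bcy (ne 1 2 isT)); rewrite ?sX //; mem.
have oady : old [set a; d; y].
  by apply: (old_meet2 ady (ne 0 3 isT)); rewrite ?sX //; mem.
have oadw : old [set a; d; w].
  by apply: (old_meet2 adw (ne 0 3 isT)); rewrite ?sX //; mem.
have ayzb : [set a; y; z] \in triples [set a; b; y; z].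
  by apply: tri; rewrite (us [:: 0; 4; 5]) //=; mem.
have abyb : [set a; b; y] \in triples [set a; b; y; z].
  by apply: tri; rewrite (us [:: 0; 1; 4]) //=; mem.
have ayzd : [set a; y; z] \in triples [set a; d; y; z].
  by apply: tri; rewrite (us [:: 0; 4; 5]) //=; mem.
have adyd : [set a; d; y] \in triples [set a; d; y; z].
  by apply: tri; rewrite (us [:: 0; 3; 4]) //=; mem.
have e1 : col [set b; c; y] = col [set a; b; y].
  by apply: (old_pinned uab sab ayzb abyb nT oaby obcy bcy (ne 1 4 isT)); mem.
have e2 : col [set a; d; y] = col [set a; b; y].
  by apply: (old_pinned uab sab ayzb abyb nT oaby oady ady (ne 0 4 isT)); mem.
have e3 : col [set a; d; w] = col [set a; d; y].
  by apply: (old_pinned uad sad ayzd adyd nT oady oadw adw (ne 0 3 isT)); mem.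
have := col_proper (cards3 (us [:: 1; 2; 4] isT)) (cards3 (us [:: 0; 3; 6] isT))
  (disjoint3 (us [:: 1; 2; 4; 0; 3; 6] isT)).
by rewrite /= e1 e3 e2 eqxx.
Qed.

Lemma old_meet1 a y z : a \in X -> y \in R :\: X -> z \in R :\: X -> y != z ->
  old [set a; y; z].
Proof.
move=> aX yY zY yz.
have aR := subsetP XR a aX.
have [b [c [d [uX Xe]]]] : exists b c d, uniq [:: a; b; c; d] /\ {subset [:: a; b; c; d] <= X}.
  have X3 : #|X :\ a| = 3 by move: X4; rewrite (cardsD1 a) aX => -[].
  have [b bX] : exists b, b \in X :\ a by apply/card_gt0P; rewrite X3.
  have [c [d [u e]]] := set3_of X3 bX.
  exists b, c, d; split.
    have : a \notin X :\ a by rewrite setD11.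
    by rewrite e cons_uniq u andbT !inE -!orbA.
  move=> v; rewrite inE => /predU1P[-> //|vl].
  have : v \in X :\ a by rewrite e !inE -!orbA; move: vl; rewrite !inE.
  by case/setD1P.
have [w wY] : exists w, w \in R :\: X :\: [set y; z].
  apply/card_gt0P; rewrite cardsD (setIidPr _); last by rewrite subUset !sub1set yY zY.
  by rewrite cardsD (setIidPr XR) R8 X4 cards2 yz.
have /and3P[] : [&& w != y, w != z & w \in R :\: X].
  by move: wY; rewrite !inE negb_or -!andbA.
move=> wy wz {}wY.
apply: (@old_meet1_list a b c d y z w) => //.
  rewrite -[X in uniq X]/([:: a; b; c; d] ++ [:: y; z; w]) cat_uniq.
  apply/and3P; split=> //; last by rewrite /= !inE negb_or yz ![_ == w]eq_sym wy wz.
  apply/negP.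
  case/hasP => v vY /Xe vX; move: vY; rewrite !inE => /or3P[] /eqP ve; subst v;
  by move: yY zY wY; rewrite !inE vX.
move=> v; rewrite -[X in _ \in X]/([:: a; b; c; d] ++ [:: y; z; w]) mem_cat.
case/orP => [/Xe /(subsetP XR) //|].
rewrite !inE => /or3P[] /eqP ->; [move: yY | move: zY | move: wY];
  by rewrite inE => /andP[].
Qed.

(** If [yzw] were new, [{a, y, z, w}] would give [abw] and [acy] the same colour, and [{c, y, z, w}]
    would give [acy] that of [cyz]. But [abw] and [cyz] are disjoint. *)
Lemma old_meet0 y z w : uniq [:: y; z; w] -> {subset [:: y; z; w] <= R :\: X} ->
  old [set y; z; w].
Proof.
move=> uY sY; apply: contraT => nT.
have [s [uX sz sX]] : exists s : seq V, [/\ uniq s, size s = 3 & {subset s <= X}].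
  by apply/card_geqP; rewrite X4.
case: s uX sz sX => [|a [|b [|c [|]]]] // uX _ sX.
have u : uniq [:: a; b; c; y; z; w].
  rewrite -[X in uniq X]/([:: a; b; c] ++ [:: y; z; w]) cat_uniq.
  apply/and3P; split=> //; apply/negP; case/hasP => v /sY vY /sX vX.
  by move: vY; rewrite inE vX.
have sR : {subset [:: a; b; c; y; z; w] <= R}.
  move=> v; rewrite -[X in _ \in X]/([:: a; b; c] ++ [:: y; z; w]) mem_cat.
  by case/orP => [/sX /(subsetP XR) //|/sY]; rewrite inE => /andP[].
have us s := @uniq_sel _ a _ s u.
have inR i : i < 6 -> nth a [:: a; b; c; y; z; w] i \in R.
  by move=> i7; apply/sR/mem_nth.
have tri p q r Z : uniq [:: p; q; r] && all (fun x => x \in Z) [:: p; q; r] ->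
    [set p; q; r] \in triples Z.
  by case/andP=> upqr /and4P[*]; exact: triples3.
have four p q r s : uniq [:: p; q; r; s] && all (fun i => i < 6) [:: p; q; r; s] ->
  let l := [seq nth a [:: a; b; c; y; z; w] i | i <- [:: p; q; r; s]] in
  uniq l /\ {subset l <= R}.
  move=> h; split; first exact: us.
  by move=> x /mapP[i il ->]; apply: inR; case/andP: h => _ /allP; apply.
have [ua sa] := four 0 3 4 5 isT; have [uc sc] := four 2 3 4 5 isT.
have ne i j : [&& i < 6, j < 6 & i != j] ->
    nth a [:: a; b; c; y; z; w] i != nth a [:: a; b; c; y; z; w] j.
  by case/and3P => i7 j7; rewrite nth_uniq.
have aby : [set a; b; y] \in triples R.
  by apply: tri; rewrite (us [:: 0; 1; 3]) //= !sR //; mem.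
have abw : [set a; b; w] \in triples R.
  by apply: tri; rewrite (us [:: 0; 1; 5]) //= !sR //; mem.
have acy : [set a; c; y] \in triples R.
  by apply: tri; rewrite (us [:: 0; 2; 3]) //= !sR //; mem.
have oabw : old [set a; b; w].
  by apply: (old_meet2 abw (ne 0 1 isT)); rewrite ?sX //; mem.
have oacy : old [set a; c; y].
  by apply: (old_meet2 acy (ne 0 2 isT)); rewrite ?sX //; mem.
have oayz : old [set a; y; z].
  by apply: old_meet1; rewrite ?sX ?sY ?(ne 3 4) //; mem.
have oczy : old [set c; y; z].
  by apply: old_meet1; rewrite ?sX ?sY ?(ne 3 4) //; mem.
have yzwa : [set y; z; w] \in triples [set a; y; z; w].
  by apply: tri; rewrite (us [:: 3; 4; 5]) //=; mem.
have yzwc : [set y; z; w] \in triples [set c; y; z; w].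
  by apply: tri; rewrite (us [:: 3; 4; 5]) //=; mem.
have ayza : [set a; y; z] \in triples [set a; y; z; w].
  by apply: tri; rewrite (us [:: 0; 3; 4]) //=; mem.
have cyzc : [set c; y; z] \in triples [set c; y; z; w].
  by apply: tri; rewrite (us [:: 2; 3; 4]) //=; mem.
have e1 : col [set a; b; w] = col [set a; y; z].
  by apply: (old_pinned ua sa yzwa ayza nT oayz oabw abw (ne 0 5 isT)); mem.
have e2 : col [set a; c; y] = col [set a; y; z].
  by apply: (old_pinned ua sa yzwa ayza nT oayz oacy acy (ne 0 3 isT)); mem.
have e3 : col [set a; c; y] = col [set c; y; z].
  by apply: (old_pinned uc sc yzwc cyzc nT oczy oacy acy (ne 2 3 isT)); mem.
have := col_proper (cards3 (us [:: 0; 1; 5] isT)) (cards3 (us [:: 2; 3; 4] isT))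
  (disjoint3 (us [:: 0; 1; 5; 2; 3; 4] isT)).
by rewrite /= e1 -e2 e3 eqxx.
Qed.

Lemma all_old T : T \in triples R -> old T.
Proof.
move=> TR; have [TsR T3] := triplesP _ _ TR.
have [noX|[a]] := set_0Vmem (T :&: X).
  have [a aT] : exists a, a \in T by apply/card_gt0P; rewrite T3.
  have [s [t [u Te]]] := set3_of T3 aT.
  rewrite Te; apply: old_meet0 => // v vl.
  have vT : v \in T by rewrite Te; move: vl; rewrite !inE orbA.
  rewrite inE (subsetP TsR) // andbT; apply/negP => vX.
  by have := in_set0 v; rewrite -noX inE vT vX.
rewrite inE => /andP[aT aX].
have [s [t [u Te]]] := set3_of T3 aT.
have sT : s \in T by rewrite Te; mem.
have tT : t \in T by rewrite Te; mem.
move: (u); rewrite /= !inE negb_or andbT => /andP[/andP[as_ at_] st].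
have [sX|sX] := boolP (s \in X); first exact: (old_meet2 TR as_).
have [tX|tX] := boolP (t \in X); first exact: (old_meet2 TR at_).
by rewrite Te; apply: old_meet1; rewrite // inE ?sX ?tX (subsetP TsR).
Qed.

(** With only two colours on [R], triples spanning at most four points both differ in colour from a
    triple disjoint from them, hence agree. *)
Lemma eight_points_contra : False.
Proof.
apply: (@not_locally_constant R); first by rewrite R8.
move=> S T SR TR ST; have [SsR S3] := triplesP _ _ SR; have [TsR T3] := triplesP _ _ TR.
have [||U UR] := @exists_triple_avoiding R (S :|: T).
- by rewrite subUset SsR.
- by rewrite R8; move: ST; clear; lia.
rewrite subsetD disjoint_sym => /andP[_ dU].
have [_ U3] := triplesP _ _ UR.
have US : col U != col S.
  by apply: col_proper => //; apply: disjointWr dU; exact: subsetUl.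
have UT : col U != col T.
  by apply: col_proper => //; apply: disjointWr dU; exact: subsetUr.
move: (all_old UR) (all_old SR) (all_old TR) US UT.
by rewrite /old => /orP[] /eqP-> /orP[] /eqP-> /orP[] /eqP->; rewrite ?eqxx.
Qed.

End EightPoints.

(** * Seven points *)

Lemma seven_points R : #|R| = 7 -> ~ few_colors R.
Proof.
move=> R7 few; apply: (@not_locally_constant R); first by rewrite R7.
move=> S T SR TR ST; have [SsR S3] := triplesP _ _ SR; have [TsR T3] := triplesP _ _ TR.
have [||U UR sU] := @exists_triple_avoiding R (S :|: T).
- by rewrite subUset SsR.
- by rewrite R7; move: ST; clear; lia.
(* Outside [U] only one colour is allowed, and both [S] and [T] lie there. *)
have := few U UR; rewrite R7 ltnS => /card_le1_eqP; apply; apply/imset_f/triplesP;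
  by split=> //; apply: subset_trans sU; rewrite ?subsetUl ?subsetUr.
Qed.

(** * Nine points or more *)

Definition color_class R k := [set T in triples R | col T == k].
(** The family [G] of the overview: a triple [A] of [R] lies outside it exactly when colour [k] is
    visible in [R :\: A]. *)
Definition transversals R k :=
  [set A in triples R | [forall T in color_class R k, ~~ [disjoint T & A]]].

Lemma color_class_sub R k : color_class R k \subset transversals R k.
Proof.
apply/subsetP => T; rewrite !inE => /andP[/andP[TR T3] /eqP Tk].
rewrite TR T3; apply/forall_inP => S; rewrite !inE => /andP[/andP[SR S3] /eqP Sk].
by apply/negP => /(col_proper (eqP S3) (eqP T3)); rewrite Sk Tk eqxx.
Qed.

Lemma transversals_cross R k T A : T \in color_class R k -> A \in transversals R k ->
  exists2 x, x \in T & x \in A.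
Proof.
move=> Tk; rewrite inE => /andP[_ /forall_inP /(_ T Tk)].
by rewrite -setI_eq0 => /set0Pn[x]; rewrite inE => /andP[]; exists x.
Qed.

Lemma no_common_point R : 3 < #|R| -> few_colors R ->
  (forall x, x \in R -> exists2 A, A \in triples (R :\ x) &
     #|R| - 6 <= #|colors (R :\ x :\: A)|) ->
  forall k x, exists2 A, A \in transversals R k & x \notin A.
Proof.
move=> R4 few IH k x.
suff inR y : y \in R -> exists2 A, A \in transversals R k & y \notin A.
  have [/inR //|xR] := boolP (x \in R).
  have [y yR] : exists y, y \in R by apply/card_gt0P/ltnW/ltnW/ltnW.
  have [A AT _] := inR y yR; exists A => //; apply: contraNN xR.
  by move: AT; rewrite !inE => /andP[/andP[/subsetP AR _] _] /AR.
move=> {x} yR; apply/exists_inP; apply: contraT => /exists_inPn nA.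
have {}nA A : A \in transversals R k -> y \in A by move/nA; rewrite negbK.
have [A /triplesP[ARy A3] cA] := IH y yR.
have [AR yA] : A \subset R /\ y \notin A by move: ARy; rewrite subsetD1 => /andP[].
have AR3 : A \in triples R by apply/triplesP.
have : A \notin transversals R k by apply: contraNN yA => /nA.
rewrite inE AR3 => /forall_inPn[T Tk]; rewrite negbK => dTA.
have := few A AR3; rewrite ltnNge => /negP[].
move: (Tk); rewrite inE => /andP[TR /eqP Tcol].
have [TsR T3] := triplesP _ _ TR.
have kA : k \in colors (R :\: A).
  by rewrite -Tcol imset_f //; apply/triplesP; rewrite subsetD TsR dTA.
(* All triples of colour [k] contain [y], so removing [y] hides this colour, which [T] shows in
   [R :\: A]. *)
have sub : colors (R :\ y :\: A) \subset colors (R :\: A) :\ k.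
  rewrite subsetD1 colorsS ?setSD ?subD1set //=; apply/imsetP => -[S SA Sk].
  have [SsA S3] := triplesP _ _ SA.
  have SR : S \in color_class R k.
    rewrite inE Sk eqxx andbT; apply: (subsetP (triplesS _)) SA.
    by rewrite !subDset; apply/subsetP => v vR; rewrite !inE vR !orbT.
  have yS := nA S (subsetP (color_class_sub R k) S SR).
  by have := subsetP SsA y yS; rewrite !inE eqxx andbF.
have := subset_leq_card sub; have := cardsD1 k (colors (R :\: A)).
by rewrite kA; move: cA R4; clear; lia.
Qed.

(** * The weighting of triples relative to [X] *)

Section Weights.
Variables (R X : {set V}).
Hypothesis XR : X \subset R.
Let m := #|X|.
Hypotheses (Rm : #|R| = m + 4) (m5 : 5 <= m).

(** The values balance pair degrees: a pair inside [X] gets at most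
    [(m - 2) * (m - 5) + 4 * (m - 2)], a pair with one point in [X] at most [(m - 1) * (m - 2)], and
    these agree. Triples whose colour [X] does not control weigh 0. *)
Definition weight T := match #|T :&: X| with 3 => m - 5 | 2 => m - 2 | _ => 0 end.

Lemma weight_leM T : weight T <= m - 2.
Proof. by rewrite /weight; case: #|_| => [|[|[|[|]]]] //; apply: leq_sub2l. Qed.

Lemma card_meet3 x y z : uniq [:: x; y; z] ->
  #|[set x; y; z] :&: X| = (x \in X) + (y \in X) + (z \in X).
Proof.
move=> u; rewrite -sum1_card (eq_bigl (fun t => (t \in [set x; y; z]) && (t \in X)));
  last by move=> t; rewrite inE.
move: u; rewrite big_mkcondr /= !inE negb_or andbT => /andP[/andP[xy xz] yz].
rewrite setUC big_setU1 /=; last by rewrite !inE negb_or ![z == _]eq_sym xz.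
rewrite big_setU1 ?inE //= big_set1 addnC.
by do 3![case: (_ \in X)].
Qed.

Lemma pair_weight_reindex (P : pred {set V}) x y : x != y ->
  {subset P <= triples R} ->
  \sum_(T in P | (x \in T) && (y \in T)) weight T <=
  \sum_(z in R :\ x :\ y) weight [set x; y; z].
Proof.
move=> xy PR.
have inj : {in R :\ x :\ y &, injective (fun z => [set x; y; z])}.
  move=> z t; rewrite !inE => /and3P[zy zx _] _ /setP /(_ z).
  by rewrite !inE eqxx orbT (negbTE zx) (negbTE zy) => /esym/eqP.
rewrite -(big_imset weight inj) /=; apply: sub_le_big => //=.
  by move=> a b; rewrite leq_addr.
move=> T /and3P[/PR TR xT yT]; have [TsR T3] := triplesP _ _ TR.
have [s [t [u Te]]] := set3_of T3 xT.
have [z [zy zx zT]] : exists z, [/\ z != y, z != x & z \in T].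
  move: u yT; rewrite Te /= !inE negb_or [y == x]eq_sym (negbTE xy) andbT /=.
  case/andP=> /andP[xs xt] st /orP[] /eqP ys; subst y.
    by exists t; rewrite !inE eqxx orbT ![t == _]eq_sym.
  by exists s; rewrite !inE eqxx orbT [s == x]eq_sym.
apply/imsetP; exists z; first by rewrite !inE zy zx (subsetP TsR).
by apply: eq_set3 => //=; rewrite !inE negb_or xy ![_ == z]eq_sym zx zy.
Qed.

Lemma pair_weight (P : pred {set V}) x y : x != y -> {subset P <= triples R} ->
  \sum_(T in P | (x \in T) && (y \in T)) weight T <= (m - 1) * (m - 2).
Proof.
move=> xy PR; apply: leq_trans (pair_weight_reindex xy PR) _.
have W z : z \in R :\ x :\ y -> weight [set x; y; z] =
    match (x \in X) + (y \in X) + (z \in X) with 3 => m - 5 | 2 => m - 2 | _ => 0 end.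
  rewrite !inE => /and3P[zy zx _]; rewrite /weight card_meet3 //=.
  by rewrite !inE negb_or xy ![_ == z]eq_sym zx zy.
rewrite (eq_bigr _ W).
set E := R :\ x :\ y.
have Xc : #|E :&: X| = m - (x \in X) - (y \in X).
  have -> : E :&: X = X :\ x :\ y.
    apply/setP => v; rewrite !inE; have := subsetP XR v.
    by case: (v \in X) => [->|]; rewrite ?andbT ?andbF.
  have := cardsD1 x X; have := cardsD1 y (X :\ x).
  by rewrite in_setD1 [y == x]eq_sym xy /= -/m; clear; lia.
have Yc : #|E :\: X| <= 4.
  apply: leq_trans (_ : #|R :\: X| <= _).
    by apply/subset_leq_card/setSD; rewrite !subDset; apply/subsetP => v vR; rewrite !inE vR !orbT.
  by rewrite cardsD (setIidPr XR) Rm -/m addKn.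
rewrite (bigID (fun z => z \in X)) /=.
under eq_bigr => z /andP[_ zX] do rewrite zX.
under [X in _ + X]eq_bigr => z /andP[_ zX] do rewrite (negbTE zX).
rewrite !sum_nat_const.
have -> : #|[pred z | (z \in E) && (z \in X)]| = #|E :&: X|.
  by apply: eq_card => z; rewrite !inE.
have -> : #|[pred z | (z \in E) && (z \notin X)]| = #|E :\: X|.
  by apply: eq_card => z; rewrite !inE andbC.
rewrite Xc; move: Yc; move: #|E :\: X| m5 => q; rewrite -/m; clear.
by case: (x \in X); case: (y \in X) => /=; nia.
Qed.

Lemma total_weight :
  'C(m, 3) * (m - 5) + 4 * 'C(m, 2) * (m - 2) <= \sum_(T in triples R) weight T.
Proof.
rewrite (bigID (fun T => #|T :&: X| == 3)) /=; apply: leq_add.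
  rewrite (eq_bigr (fun=> m - 5)); last by move=> T /andP[_ /eqP e]; rewrite /weight e.
  rewrite sum_nat_const leq_mul2r; apply/orP; right.
  rewrite -cards_draws; apply/subset_leq_card/subsetP => T.
  rewrite inE => /andP[TX T3].
  by rewrite -topredE /= !inE (subset_trans TX XR) T3 (setIidPl TX) T3.
rewrite (bigID (fun T => #|T :&: X| == 2)) /=; apply: leq_trans (leq_addr _ _).
rewrite (eq_bigr (fun=> m - 2)); last by move=> T /andP[_ /eqP e]; rewrite /weight e.
rewrite sum_nat_const leq_mul2r; apply/orP; right.
(* Triples with two points in [X] are built from one of four outside points and a pair in [X];
   intersection and difference with [X] recover both. *)
pose f (p : V * {set V}) := p.1 |: p.2.
pose Dm := setX (R :\: X) [set P : {set V} | P \subset X & #|P| == 2].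
have Y4 : #|R :\: X| = 4 by rewrite cardsD (setIidPr XR) Rm -/m addKn.
have <- : #|Dm| = 4 * 'C(m, 2) by rewrite cardsX Y4 cards_draws.
have meet p : p \in Dm -> f p :&: X = p.2.
  rewrite !inE => /andP[/andP[pX _] /andP[PX _]].
  rewrite setIUl (setIidPl PX); apply/setUidPr/subsetP => v.
  by rewrite !inE => /andP[/eqP-> ]; rewrite (negbTE pX).
have diff p : p \in Dm -> f p :\: X = [set p.1].
  rewrite !inE => /andP[/andP[pX _] /andP[PX _]].
  rewrite setDUl; have -> : p.2 :\: X = set0 by apply/eqP; rewrite setD_eq0.
  rewrite setU0; apply/setP => v; rewrite !inE.
  by case: eqP => [->|]; rewrite ?pX ?andbF.
rewrite -(@card_in_imset _ _ f); last first.
  move=> [a P] [b Q] pD qD e; have := meet _ pD; have := diff _ pD.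
  by rewrite e diff // meet //= => /set1_inj -> ->.
apply/subset_leq_card/subsetP => _ /imsetP[p pD ->].
have me := meet p pD.
move: (pD); rewrite !inE => /andP[/andP[pX pR] /andP[PX P2]].
rewrite -topredE /= !inE me (eqP P2) /= andbT subUset sub1set pR (subset_trans PX XR) /=.
by rewrite cardsU1 (eqP P2) (contraNN (subsetP PX p.1)).
Qed.

End Weights.

(** With [p = m - 5], the left side is [m - 2] colours times the class bound. The margin is small:
    at [p = 0] it reads [117 < 120]. *)
Lemma weight_arith p : (3 * p + 13) * ((p + 3) * (p + 3)) <
  'C(p + 5, 3) * p + 4 * 'C(p + 5, 2) * (p + 3).
Proof.
have c3 : 6 * 'C(p + 5, 3) = (p + 5) * (p + 4) * (p + 3).
  by rewrite mulnC -[6]/(3`!) bin_ffact !ffactnS ffactn0 muln1 !addnS /= mulnA.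
have c2 : 2 * 'C(p + 5, 2) = (p + 5) * (p + 4).
  by rewrite mulnC -[2]/(2`!) bin_ffact !ffactnS ffactn0 muln1 !addnS.
nia.
Qed.

Lemma nine_points_contra R X : X \subset R -> #|R| = #|X| + 4 -> 5 <= #|X| ->
  few_colors R -> #|R| - 6 <= #|colors X| ->
  (forall k x, exists2 A, A \in transversals R k & x \notin A) -> False.
Proof.
move=> XR Rm m5 few cX nocommon.
have XcR : #|X| + 4 <= #|R| by rewrite Rm.
have cXle : #|colors X| <= #|X| - 2.
  have : #|X| + 3 <= #|R| by rewrite Rm leq_add2l.
  by move=> /(few_colors_sub few XR); rewrite Rm; clear; lia.
pose w := weight X.
have old T : T \in triples R -> w T != 0 -> col T \in colors X.
  move=> TR wT; have : 1 < #|T :&: X|.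
    by move: wT; rewrite /w /weight; case: #|_| => [|[|]].
  case/card_gt1P => x [y [+ + xy]]; rewrite !inE => /andP[xT xX] /andP[yT yX].
  exact: (dominated_color few XR XcR cX TR xy).
have class_le k : \sum_(T in color_class R k) w T <=
    (3 * (#|X| - 1) + 1) * (#|X| - 2).
  (* Here [D = #|X| - 1] and [M = #|X| - 2], so [5 <= #|X|] supplies [4 <= D]. *)
  apply: (@intersecting_weight_le _ (color_class R k) (transversals R k)).
  - by move=> T; rewrite inE => /andP[/triplesP[]].
  - by move=> T; rewrite inE => /andP[/triplesP[]].
  - exact: color_class_sub.
  - by move=> T A; exact: transversals_cross.
  - exact: nocommon.
  - exact: weight_leM.
  - move=> x y xy; apply: (@pair_weight R X XR Rm m5 (mem (color_class R k)) x y xy).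
    by move=> T; rewrite !inE => /andP[].
  - by move: m5; clear; lia.
have tot : \sum_(T in triples R) w T <= #|colors X| * ((3 * (#|X| - 1) + 1) * (#|X| - 2)).
  rewrite -sum_nat_const.
  apply: leq_trans (_ : \sum_(k in colors X) \sum_(T in color_class R k) w T <= _);
    last by apply: leq_sum => k _; exact: class_le.
  rewrite (bigID (fun T => col T \in colors X)) /= addnC big1 ?add0n; last first.
    by move=> T /andP[TR]; apply: contraNeq => /(old T TR).
  rewrite (partition_big col (mem (colors X))) /=; last by move=> T /andP[].
  apply: leq_sum => k kX; rewrite leq_eqVlt; apply/orP; left; apply/eqP.
  apply: eq_bigl => T; rewrite [in RHS]inE -andbA; congr (_ && _).
  by case: eqP => [->|]; rewrite ?kX ?andbF ?andbT.
have := leq_trans (total_weight XR Rm) tot.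
have [p pE] : exists p, #|X| = p + 5 by exists (#|X| - 5); rewrite subnK.
rewrite -/w pE in cXle *; rewrite addnK.
have := weight_arith p; move: cXle; move: #|colors X| => c.
have -> : p + 5 - 2 = p + 3 by lia.
have -> : 3 * (p + 5 - 1) + 1 = 3 * p + 13 by lia.
move=> cp h1 h2; have h3 : c * ((3 * p + 13) * (p + 3)) <= (3 * p + 13) * ((p + 3) * (p + 3)).
  by rewrite mulnCA leq_mul2l leq_mul2r cp !orbT.
by have := leq_trans h1 (leq_trans h2 h3); rewrite ltnn.
Qed.

(** * The induction on the number of points *)

Theorem many_colors_avoiding R : 3 <= #|R| ->
  exists2 A, A \in triples R & #|R| - 5 <= #|colors (R :\: A)|.
Proof.
move: {2}#|R| (leqnn #|R|) => n; elim: n R => [|n IHn] R Rn R3.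
  by have := leq_trans R3 Rn.
apply/exists_inP; apply: contraT => /exists_inPn no.
have few : few_colors R by move=> A /no; rewrite -ltnNge.
have [R5|R6] := leqP #|R| 5.
  have [A /few] := exists_triple R3.
  by move: R5; rewrite -subn_eq0 => /eqP->.
have [R6e|R7] := leqP #|R| 6.
  have {}R6e : #|R| = 6 by apply/eqP; rewrite eqn_leq R6e R6.
  have [A AR] := exists_triple R3; have [AsR A3] := triplesP _ _ AR.
  have [|T TA] := @exists_triple (R :\: A); first by rewrite cardsD (setIidPr AsR) R6e A3.
  have := few A AR; rewrite R6e ltnS leqn0 cards_eq0 => /eqP c0.
  by have := imset_f col TA; rewrite -/(colors _) c0 inE.
have IH x : x \in R -> exists2 A, A \in triples (R :\ x) &
     #|R| - 6 <= #|colors (R :\ x :\: A)|.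
  move=> xR; have Rx := cardsD1 x R; rewrite xR in Rx.
  have [||A AR cA] := IHn (R :\ x); try by (move: Rx Rn R7; clear; lia).
  by exists A => //; move: cA; rewrite Rx.
have [R7e|R8] := leqP #|R| 7.
  by case: (@seven_points R) => //; apply/eqP; rewrite eqn_leq R7e R7.
have [x xR] : exists x, x \in R by apply/card_gt0P; apply: leq_trans R8.
have [A /triplesP[AR A3] cX] := IH x xR.
(* [X] loses four points of [R] and shows as many colours as [few_colors] permits. *)
set X := R :\ x :\: A in cX.
have XR : X \subset R by rewrite (subset_trans (subsetDl _ _)) ?subD1set.
have Xc : #|R| = #|X| + 4.
  have := cardsD1 x R; have := subset_leq_card AR.
  by rewrite /X xR [#|_ :\: A|]cardsD (setIidPr AR) A3; clear; lia.
have [R8e|R9] := leqP #|R| 8.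
  have {}R8e : #|R| = 8 by apply/eqP; rewrite eqn_leq R8e R8.
  have X4 : #|X| = 4 by move: Xc; rewrite R8e => /eqP; rewrite -[8]/(4 + 4) eqn_add2r => /eqP.
  move: cX; rewrite R8e => /card_gt1P[k1 [k2 [/imsetP[P1 P1X ->] /imsetP[P2 P2X ->] P12]]].
  by case: (@eight_points_contra R R8e few X P1 P2).
case: (@nine_points_contra R X) => //; first by move: R9; rewrite Xc; clear; lia.
by apply: no_common_point => //; exact: leq_trans R6.
Qed.

End Coloring.


(** * Back to the Kneser graph: lower bound and optimal colouring *)

Lemma locality_ge n (c : kvert n 3 -> nat) : 6 <= n -> proper_coloring c ->
  n - 4 <= locality c.
Proof.
move=> n6 cp.
(* A finite colour type containing all values of [c]; sets that are not triples get the dummy colour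
   [ord0]. *)
pose K := 'I_(\max_v c v).+1.
pose col (T : {set 'I_n}) : K := if insub T is Some v then inord (c v) else ord0.
have colE (v : kvert n 3) : col (val v) = c v :> nat.
  by rewrite /col valK inordK // ltnS leq_bigmax.
have col_proper (S T : {set 'I_n}) : #|S| = 3 -> #|T| = 3 -> [disjoint S & T] -> col S != col T.
  move=> /eqP S3 /eqP T3 dST.
  rewrite -val_eqE /= (colE (Sub S S3)) (colE (Sub T T3)); exact: cp.
have [|A /triplesP[_ A3]] := many_colors_avoiding col_proper (R := setT).
  by rewrite cardsT card_ord; apply: leq_trans n6.
rewrite cardsT card_ord setTD => cA.
pose v : kvert n 3 := Sub A (introT eqP A3).
apply: leq_trans (leq_bigmax v); rewrite /closed_nbhd_colors.
set s := [seq c u | u <- _].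
(* By properness the colour of [A] is absent outside [A], which raises [n - 5] to [n - 4]. *)
pose s' := col A :: enum (colors col (~: A)).
have us' : uniq (map val s').
  rewrite map_inj_uniq; last exact: val_inj.
  rewrite /= enum_uniq andbT mem_enum; apply/imsetP => -[T].
  case/triplesP=> TA T3 e.
  have dAT : [disjoint A & T] by rewrite disjoint_sym disjoints_subset.
  by have := col_proper _ _ A3 T3 dAT; rewrite e eqxx.
have sub : {subset map val s' <= undup s}.
  move=> x; rewrite mem_undup => /mapP[k]; rewrite inE => /predU1P[-> ->|].
    by rewrite [val _](colE v); apply: map_f; rewrite mem_enum inE eqxx.
  rewrite mem_enum => /imsetP[T /triplesP[TA /eqP T3] -> ->].
  rewrite [val _](colE (Sub T T3)); apply: map_f; rewrite mem_enum inE.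
  by rewrite /kadj /= disjoint_sym disjoints_subset TA orbT.
apply: leq_trans (uniq_leq_size us' sub).
rewrite size_map /= -cardE (_ : n - 4 = (n - 5).+1) ?ltnS //.
by move: n6; clear; lia.
Qed.

(* Stars centred at the points [5, ..., n - 1]; the triples inside [{0, ..., 4}]
   pairwise meet and share colour 4. *)
Definition star_coloring n (v : kvert n 3) : nat := maxn 4 (\max_(i in val v) i).

(** A common colour of at least 5 is a shared point; a common colour 4 puts both triples among five
    points. *)
Lemma star_coloring_proper n : proper_coloring (@star_coloring n).
Proof.
move=> u v uv; apply/eqP => e.
have attained (w : kvert n 3) : exists2 i, i \in val w & \max_(j in val w) j = i :> nat.
  have [|i iw mi] := @eq_bigmax_cond _ (mem (val w)) (@nat_of_ord n); last by exists i.
  by rewrite (eqP (valP w)).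
have [i iu mu] := attained u; have [j jv mv] := attained v.
move: e; rewrite /star_coloring mu mv => e.
have [i5|i4] := leqP 5 i.
  have ij : i = j by apply/val_inj => /=; move: e i5; clear; lia.
  by move: uv; rewrite /kadj disjoint_subset => /subsetP /(_ i iu); rewrite inE ij jv.
have j4 : j < 5 by move: e i4; clear; lia.
have: #|val u :|: val v| <= 5.
  rewrite cardE -(size_map val) -[5](size_iota 0 5); apply: uniq_leq_size.
    by rewrite map_inj_uniq ?enum_uniq //; exact: val_inj.
  move=> k /mapP[t]; rewrite mem_enum mem_iota inE => tuv ->.
  case/orP: tuv => t_in.
    by apply: leq_ltn_trans i4; rewrite -mu; exact: leq_bigmax_cond.
  by apply: leq_ltn_trans j4; rewrite -mv; exact: leq_bigmax_cond.
by rewrite cardsU disjoint_setI0 // cards0 (eqP (valP u)) (eqP (valP v)).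
Qed.

Theorem mainTheorem4 (n : nat) : 6 <= n -> local_chromatic_number_is n 3 (n - 4).
Proof.
move=> n6; split; last by move=> c; exact: locality_ge.
exists (@star_coloring n); have cp := @star_coloring_proper n.
split=> //; apply/eqP; rewrite eqn_leq locality_ge // andbT.
(* All colours lie in [4, ..., n - 1], so no neighbourhood sees more than [n - 4]. *)
apply/bigmax_leqP => v _; rewrite /closed_nbhd_colors -(size_iota 4 (n - 4)).
apply: uniq_leq_size; first exact: undup_uniq.
move=> k; rewrite mem_undup mem_iota => /mapP[u _ ->].
rewrite subnKC; last exact: leq_trans n6.
rewrite leq_maxl gtn_max (leq_trans _ n6) //=.
have n0 : 0 < n by exact: leq_trans n6.
apply: (@leq_ltn_trans n.-1); last by rewrite prednK.
by apply/bigmax_leqP => i _; rewrite -ltnS prednK.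
Qed.
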